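(* There is an absolute constant $d>0$ such that $g(n)=\Omega\bigl(n^{2-\frac{d}{\sqrt{\log n}}}\bigr)$; that is, there are absolute constants $d>0$ and $c>0$ such that $g(n)\ge c\, n^{2-\frac{d}{\sqrt{\log n}}}$ for all sufficiently large integers $n$. Here $g(n)$ is the maximum possible cardinality of an anti-chain in the poset $\mathcal{A}(P)$ of linearly separable subsets of $P$ (ordered by inclusion), over all sets $P$ of $n$ points in the plane, no three of which are collinear.
   Context: Let $P$ be a set of $n$ points in the plane $\mathbb{R}^2$, no three of which are collinear. A subset of $P$ is called linearly separable if it is the intersection of $P$ with a closed half-plane. $\mathcal{A}(P)$ denotes the family of all linearly separable subsets of $P$, partially ordered by inclusion. An anti-chain is a subfamily in which no member is contained in another member. *)

(* Defs.v *)
From mathcomp Require Import all_boot all_order all_algebra finmap lra.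
From mathcomp Require Import all_classical all_reals all_analysis.

Set Implicit Arguments.
Unset Strict Implicit.
Unset Printing Implicit Defensive.

Import Order.TTheory GRing.Theory Num.Theory.

Local Open Scope classical_set_scope.
Local Open Scope card_scope.
Local Open Scope ring_scope.

Notation plane R := (R * R)%type.

Section Plane.
Variable R : realType.
Implicit Types (P A H L : set (plane R)) (F : set (set (plane R))).

Definition is_line L : Prop :=
  exists a b c : R, (a, b) <> (0, 0) /\
    L = [set x : plane R | a * x.1 + b * x.2 = c].

Definition is_closed_half_plane H : Prop :=
  exists a b c : R, (a, b) <> (0, 0) /\
    H = [set x : plane R | a * x.1 + b * x.2 <= c].

Definition collinear (p q r : plane R) : Prop :=
  exists L, [/\ is_line L, L p, L q & L r].

Definition no_three_collinear P : Prop :=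
  forall p q r, P p -> P q -> P r -> p <> q -> q <> r -> p <> r ->
    ~ collinear p q r.

Definition linearly_separable P A : Prop :=
  exists H, is_closed_half_plane H /\ A = P `&` H.

Definition separable_family P : set (set (plane R)) :=
  [set A | linearly_separable P A].

Definition antichain F : Prop :=
  forall A B, F A -> F B -> A `<=` B -> A = B.

Definition antichain_size (n k : nat) : Prop :=
  exists P F, [/\ P #= `I_n, no_three_collinear P,
    F `<=` separable_family P, antichain F & F #= `I_k].

End Plane.

(* The range k <= 2 ^ n excludes no admissible size, see antichain_size_le;
   g_attained and g_max state that g R n is indeed the maximum. *)
Definition g (R : realType) (n : nat) : nat :=
  (\max_(k < (2 ^ n).+1 | `[< antichain_size R n k >]) k)%N.

Lemma antichain_size_le (R : realType) (n k : nat) :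
  antichain_size R n k -> (k <= 2 ^ n)%N.
Proof.
move=> [P [F [Pn _ sF _ Fk]]].
have fP : finite_set P by apply/finite_setP; exists n.
pose X := fset_set P.
have Xn : #|` X|%N = n by exact: card_fset_set.
have finF A : F A -> finite_set A /\ A `<=` P.
  move=> /sF[H [_ ->]]; split; last exact: subIsetl.
  by apply: (sub_finite_set _ fP); exact: subIsetl.
have injF : {in F &, injective (fun A : set (plane R) => fset_set A)}.
  move=> A B /set_mem/finF[fA _] /set_mem/finF[fB _] e.
  by rewrite -(fset_setK fA) -(fset_setK fB) e.
have sub : [set fset_set A | A in F] `<=` [set` fpowerset X].
  move=> _ [A /finF[fA AP] <-] /=; rewrite fpowersetE.
  apply/fsubsetP => x; rewrite in_fset_set// => /set_mem/AP.
  by rewrite /X in_fset_set// => ?; exact/mem_set.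
have := subset_card_le sub.
rewrite (card_le_eql (inj_card_eq injF)) (card_le_eql Fk).
have e : [set` fpowerset X] #= `I_(2 ^ n).
  by apply/card_eq_fsetP; rewrite card_fpowerset Xn.
by rewrite (card_le_eqr e) card_le_II.
Qed.

Lemma g_max (R : realType) (n k : nat) :
  antichain_size R n k -> (k <= g R n)%N.
Proof.
move=> nk; have lek : (k < (2 ^ n).+1)%N
  by rewrite ltnS (antichain_size_le nk).
by rewrite /g (@bigop.bigmax_sup _ (Ordinal lek))//; exact/asboolP.
Qed.

Lemma antichain_size0 (R : realType) (n : nat) : antichain_size R n 0.
Proof.
pose f (i : nat) : plane R := (i%:R, i%:R ^+ 2).
exists (f @` `I_n), set0; split => //.
- by apply: inj_card_eq => i j _ _ [/eqP]; rewrite eqr_nat => /eqP.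
- move=> _ _ _ [i _ <-] [j _ <-] [k _ <-] ij jk ik [_ [[a [b [c [ab ->]]]]]].
  rewrite /= => ei ej ek; apply: ab.
  have ne (x y : nat) : f x <> f y -> (x%:R - y%:R : R) != 0.
    by move=> xy; rewrite subr_eq0 eqr_nat; apply/eqP => e; apply: xy; rewrite e.
  have e1 : a + b * (i%:R + j%:R) = 0.
    by apply: (mulfI (ne _ _ ij)); rewrite mulr0; move: ei ej; clear; lra.
  have e2 : a + b * (j%:R + k%:R) = 0.
    by apply: (mulfI (ne _ _ jk)); rewrite mulr0; move: ej ek; clear; lra.
  have b0 : b = 0.
    by apply: (mulfI (ne _ _ ik)); rewrite mulr0; move: e1 e2; clear; lra.
  by move: e1; rewrite b0 mul0r addr0 => ->.
- by rewrite II0.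
Qed.

Lemma g_attained (R : realType) (n : nat) : antichain_size R n (g R n).
Proof.
have lt0 : (0 < (2 ^ n).+1)%N
  by [].
have P0 : `[< antichain_size R n (Ordinal lt0) >].
  by apply/asboolP; exact: antichain_size0.
rewrite /g (bigop.bigmax_eq_arg (Ordinal lt0))//.
by case: arg_maxnP => // i /asboolP.
Qed.

(* Main.v *)
Require Import Defs.
From mathcomp Require Import all_boot all_order all_algebra.
From mathcomp Require Import ring lra zify.
From mathcomp Require Import all_classical all_reals all_analysis.
Import Order.TTheory GRing.Theory Num.Theory.
Import numFieldNormedType.Exports.
Local Open Scope classical_set_scope.
Local Open Scope ring_scope.

Set Implicit Arguments.
Unset Strict Implicit.
Unset Printing Implicit Defensive.

(* By duality and a perturbation, it suffices to find N oriented lines and many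
   points such that, for any two points v and w, some line has v strictly on its
   positive and w strictly on its negative side.  The points are a grid X x X
   with X = {sum_i x_i B^(t-i) | 0 <= x_i < Q_i}.  Horizontal and vertical lines
   through the grid deal with all pairs except those whose difference (p, -q)
   has p, q >= 0.  For these, orient the plane by the direction (1, -phi), phi
   the golden ratio: at the level j where the two points first differ, p and q
   reduce to digit differences smaller than Q_j = F_k, and a line of slope minus
   one of the two consecutive Fibonacci quotients around phi of denominators
   F_k, F_(k+1) separates, because no fraction of smaller denominator lies
   between these quotients.  The numerators and denominators being O(Q_j), there
   are prod_(i <= j) O(Q_i Q_j) such lines.  With log Q_j ~ t^2 / (j (j + 1)) this
   is 2^O(t) |X| for every j, while log |X| ~ t^2, whence the exponent
   2 - O(1 / sqrt (log N)). *)

(** * Fibonacci numbers and the gaps between their quotients *)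

Section Fib.
Local Open Scope nat_scope.

(* Indexed so that [fib 0 = fib 1 = 1]. *)
Fixpoint fib (n : nat) : nat :=
  if n is (n'.+1 as m).+1 then fib m + fib n' else 1.

Lemma fibSS k : fib k.+2 = fib k.+1 + fib k.
Proof. by []. Qed.

Lemma fib_gt0 k : 0 < fib k.
Proof.
have [] // : 0 < fib k /\ 0 < fib k.+1.
by elim: k => [|k [IH1 IH2]] //; rewrite fibSS addn_gt0 IH2.
Qed.

Lemma fib_leS k : fib k <= fib k.+1.
Proof. by case: k => // k; rewrite fibSS leq_addr. Qed.

Lemma fibS_le k : fib k.+1 <= 2 * fib k.
Proof. by case: k => // k; rewrite fibSS mul2n -addnn leq_add2l fib_leS. Qed.

Lemma leq_fib j k : j <= k -> fib j <= fib k.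
Proof.
move=> /subnK <-; elim: (k - j) => // i IH.
exact: leq_trans IH (fib_leS _).
Qed.

Lemma fib_leD a b : fib (a + b) <= 2 ^ b * fib a.
Proof.
elim: b => [|b IH]; first by rewrite addn0 mul1n.
rewrite addnS expnS -mulnA; apply: leq_trans (fibS_le _) _.
by rewrite leq_mul2l.
Qed.

(** As functions of [a], all three terms satisfy the Fibonacci recurrence, so two base cases
    suffice. Up to a factor 2, [fib] thus behaves like a power. *)
Lemma fib_mul_bounds a b :
  fib a * fib b <= fib (a + b) <= 2 * (fib a * fib b).
Proof.
pose P a := fib a * fib b <= fib (a + b) <= 2 * (fib a * fib b).
suff [] : P a /\ P a.+1 by [].
elim: a => [|a [IH1 IH2]]; rewrite /P.
  by rewrite add0n add1n !mul1n leqnn fib_leS fibS_le leq_pmull.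
split=> //; move: IH1 IH2; rewrite /P !addSn !fibSS mulnDl mulnDr.
by move=> /andP[? ?] /andP[? ?]; rewrite !leq_add.
Qed.

Lemma fib_exp_le k j : fib k ^ j <= fib (j * k).
Proof.
elim: j => // j IH; rewrite expnS mulSn.
have /andP[le _] := fib_mul_bounds k (j * k).
by apply: leq_trans le; rewrite leq_mul2l IH orbT.
Qed.

Lemma fib_cassini k :
  fib k.+2 * fib k + odd k = fib k.+1 * fib k.+1 + ~~ odd k.
Proof.
elim: k => // k; rewrite (fibSS k.+1) (fibSS k) /=.
by case: (odd k) => /=; nia.
Qed.

(* A fraction [q / p] in the closed interval between two consecutive Fibonacci
   quotients has [p >= fib k]. *)
Lemma fib_gap k p q : p < fib k -> (p != 0) || (q != 0) ->
  if odd k then fib k.+1 * p < fib k * q \/ fib k.+1 * q < fib k.+2 * p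
  else fib k * q < fib k.+1 * p \/ fib k.+2 * p < fib k.+1 * q.
Proof.
move=> pk pq; have := fib_cassini k; have := fib_leS k; have := fib_gt0 k.
move: (fib k) (fib k.+1) (fib k.+2) pk => a b c pa a0 ab.
case: (odd k) => /=; rewrite ?addn0 ?addn1 => cas.
- have [|h1] := ltnP (b * p) (a * q); first by left.
  have [|h2] := ltnP (b * q) (c * p); first by right.
  exfalso.
  have [u hu] : exists u, b * p = a * q + u by exists (b * p - a * q); lia.
  have [v hv] : exists v, b * q = c * p + v by exists (b * q - c * p); lia.
  (* Cassini's identity inverts the system defining [u] and [v]; since [p < a <= b], both must
     vanish. *)
  have e : p = b * u + a * v by nia.
  have u0 : u = 0 by nia.
  have v0 : v = 0 by nia.
  nia.
- have [|h1] := ltnP (a * q) (b * p); first by left.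
  have [|h2] := ltnP (c * p) (b * q); first by right.
  exfalso.
  have [u hu] : exists u, a * q = b * p + u by exists (a * q - b * p); lia.
  have [v hv] : exists v, c * p = b * q + v by exists (c * p - b * q); lia.
  have e : p = b * u + a * v by nia.
  have u0 : u = 0 by nia.
  have v0 : v = 0 by nia.
  nia.
Qed.

End Fib.

(** * The digit grid and its separating lines *)

Section Grid.
Local Open Scope nat_scope.
Variable B : nat.

(** The head of [ks] governs the least significant digit. A factor [M > 1] makes room for the levels
    of grid points; repetitions are harmless there. *)
Fixpoint digits (M : nat) (ks : seq nat) : seq nat :=
  if ks is k :: ks' then
    [seq B * x + d | x <- digits M ks', d <- iota 0 (M * fib k)]
  else [:: 0].

Definition grid : seq nat -> seq nat := digits 1.

(* [(k, c)] encodes the line [fib k.+1 * x + fib k * y = c - 1 / 2], oriented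
   upwards for [k] even and downwards for [k] odd. *)
Fixpoint helpers (ks : seq nat) : seq (nat * nat) :=
  if ks is k :: ks' then
    [seq (h.1, B * h.2) | h <- helpers ks'] ++
    [seq (i, c) | i <- [:: k; k.+1], c <- digits (fib k.+3) ks]
  else [::].

Definition level (k x y : nat) : nat := fib k.+1 * x + fib k * y.

Lemma levelMD k x y d e :
  level k (B * x + d) (B * y + e) = B * level k x y + level k d e.
Proof. by rewrite /level !mulnDr addnACA !(mulnCA _ B). Qed.

Lemma level_lt k d e g : d < g -> e < g -> level k d e < fib k.+2 * g.
Proof.
move=> dg eg; rewrite fibSS mulnDl -addnS leq_add // ?ltn_mul2l ?fib_gt0 //.
by rewrite leq_mul2l ltnW ?orbT.
Qed.

Lemma size_digits M ks : size (digits M ks) = \prod_(k <- ks) (M * fib k).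
Proof.
elim: ks => [|k ks IH]; first by rewrite big_nil.
by rewrite big_cons [size _]size_allpairs size_iota IH mulnC.
Qed.

Lemma helpers_cons k ks : helpers (k :: ks) =
  [seq (h.1, B * h.2) | h <- helpers ks] ++
  [seq (i, c) | i <- [:: k; k.+1], c <- digits (fib k.+3) (k :: ks)].
Proof. by []. Qed.

Lemma size_helpers k ks : size (helpers (k :: ks)) =
  size (helpers ks) + 2 * \prod_(i <- k :: ks) (fib k.+3 * fib i).
Proof.
rewrite helpers_cons size_cat size_map size_allpairs; congr (_ + 2 * _).
exact: (size_digits _ (k :: ks)).
Qed.

Lemma mem_digits M k ks x :
  reflect (exists x1 d, [/\ x1 \in digits M ks, d < M * fib k & x = B * x1 + d])
    (x \in digits M (k :: ks)).
Proof.
apply: (iffP allpairsP) => [[[x1 d] /= [x1P dP ->]]|[x1 [d [x1P dM ->]]]].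
  by exists x1, d; move: dP; rewrite mem_iota.
by exists (x1, d); rewrite mem_iota.
Qed.

Lemma uniq_grid ks : all (fun k => fib k <= B) ks -> uniq (grid ks).
Proof.
elim: ks => // k ks IH /= /andP[kB /IH u].
apply: allpairs_uniq; rewrite ?iota_uniq // => -[x d] [y e].
move=> /allpairsP[[? ?] /= [_ + [_ ->]]] /allpairsP[[? ?] /= [_ + [_ ->]]].
rewrite !mem_iota mul1n /= => dk ek eq.
have dB := leq_trans dk kB; have eB := leq_trans ek kB.
have B0 : 0 < B by apply: leq_ltn_trans dB.
have := congr1 (divn^~ B) eq; have := congr1 (modn^~ B) eq.
rewrite ![B * _]mulnC !modnMDl !divnMDl // !modn_small // !divn_small //.
by rewrite !addn0 => -> ->.
Qed.

(** [level] is linear, hence acts digit by digit, and widens each digit range by a factor at most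
    [fib k.+2]. *)
Lemma mem_digits_level M ks k x y : fib k.+2 <= M ->
  x \in grid ks -> y \in grid ks -> level k x y \in digits M ks.
Proof.
move=> kM; elim: ks x y => [|j ks IH] x y.
  by rewrite !inE => /eqP -> /eqP ->; rewrite /level !muln0.
move=> /mem_digits[x1 [d [x1P + ->]]] /mem_digits[y1 [e [y1P + ->]]].
rewrite !mul1n => dj ej; apply/mem_digits; exists (level k x1 y1), (level k d e).
split; [exact: IH| |exact: levelMD].
by apply: leq_trans (level_lt _ dj ej) _; rewrite leq_mul2r kM orbT.
Qed.

(** Induction on the digits: either a line for the leading digits, scaled by [B], still separates,
    or only the last digits differ and [fib_gap] applies to their differences. The bound on [B]
    keeps every level of last digits below [B]. *)
Lemma helper_separates (K : nat) ks x y x' y' :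
  all (leq^~ K) ks -> fib K.+3 * fib K <= B ->
  x \in grid ks -> y \in grid ks -> x' \in grid ks -> y' \in grid ks ->
  x' <= x -> y <= y' -> (x, y) != (x', y') ->
  exists2 h, (h \in helpers ks) && (h.1 <= K.+1) &
    if odd h.1 then level h.1 x y < h.2 <= level h.1 x' y'
    else level h.1 x' y' < h.2 <= level h.1 x y.
Proof.
move=> + KB; elim: ks x y x' y' => [|k ks IH] x y x' y'.
  by move=> _; rewrite !inE => /eqP-> /eqP-> /eqP-> /eqP->; rewrite eqxx.
move=> /= /andP[kK ksK].
have kB : fib k <= B.
  apply: leq_trans KB; apply: (@leq_trans (fib K)); first exact: leq_fib.
  by rewrite leq_pmull ?fib_gt0.
move=> xP yP x'P y'P.
case/mem_digits: (xP) => x1 [d [x1P]]; rewrite mul1n => dk xE.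
case/mem_digits: (yP) => y1 [e [y1P]]; rewrite mul1n => ek yE.
case/mem_digits: (x'P) => x1' [d' [x1'P]]; rewrite mul1n => dk' xE'.
case/mem_digits: (y'P) => y1' [e' [y1'P]]; rewrite mul1n => ek' yE'.
move=> xx yy ne.
have lex : x1' <= x1 by clear - xx xE xE' dk dk' kB; nia.
have ley : y1 <= y1' by clear - yy yE yE' ek ek' kB; nia.
have [[ex ey]|ne1] := eqVneq (x1, y1) (x1', y1'); last first.
  have [[i c] /= /andP[hP iK] sep] := IH _ _ _ _ ksK x1P y1P x1'P y1'P lex ley ne1.
  exists (i, B * c) => /=.
    by rewrite iK mem_cat; apply/andP; split=> //; apply/orP; left;
       apply/mapP; exists (i, c).
  have lev u1 v1 : u1 < fib k -> v1 < fib k -> level i u1 v1 < B.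
    move=> uk vk; apply: leq_trans KB; apply: leq_trans (level_lt _ uk vk) _.
    by rewrite leq_mul // leq_fib.
  have rB := lev _ _ dk ek; have rB' := lev _ _ dk' ek'.
  have E := levelMD i x1 y1 d e; have E' := levelMD i x1' y1' d' e'.
  rewrite -xE -yE in E; rewrite -xE' -yE' in E'.
  have lt u r : r < B -> u < c -> B * u + r < B * c.
    by move=> rB0 uc; apply: (@leq_trans (B * u.+1));
       rewrite ?leq_mul2l ?uc ?orbT // mulnS addnC ltn_add2r.
  have ge u r : c <= u -> B * c <= B * u + r.
    by move=> cu; apply: leq_trans (leq_addr _ _); rewrite leq_mul2l cu orbT.
  by rewrite E E'; move: sep => /=; case: (odd i) => /andP[s1 s2]; rewrite lt ?ge.
subst x1' y1'.
have ld : d' <= d by clear - xx xE xE'; lia.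
have le : e <= e' by clear - yy yE yE'; lia.
have pq : (d - d' != 0) || (e' - e != 0).
  rewrite -negb_and; apply: contra ne => /andP[/eqP h1 /eqP h2].
  by apply/eqP; clear - h1 h2 ld le xE xE' yE yE'; congr pair; lia.
have pk : d - d' < fib k by apply: leq_ltn_trans dk; exact: leq_subr.
have levD i : level i x y + fib i * (e' - e) = level i x' y' + fib i.+1 * (d - d').
  rewrite xE yE xE' yE' !levelMD; rewrite /level; clear - ld le; nia.
(* The factor [fib k.+3] in [helpers] serves both indices [k] and [k.+1]. *)
have mem i u v : i \in [:: k; k.+1] -> u \in grid (k :: ks) -> v \in grid (k :: ks) ->
    ((i, level i u v) \in helpers (k :: ks)) && (i <= K.+1).
  move=> ik uP vP; apply/andP; split; last first.
    by move: ik; rewrite !inE => /orP[]/eqP->; rewrite ?ltnS // leqW.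
  rewrite helpers_cons mem_cat; apply/orP; right; apply/allpairsP.
  exists (i, level i u v); split=> //; apply: (mem_digits_level _ uP vP).
  by apply: leq_fib; move: ik; rewrite !inE => /orP[]/eqP->.
have k1 : k \in [:: k; k.+1] by rewrite inE eqxx.
have k2 : k.+1 \in [:: k; k.+1] by rewrite !inE eqxx orbT.
(* The inequalities offered by [fib_gap] agree with the orientations that the parities of [k] and
   [k.+1] prescribe. *)
have E1 := levD k; have E2 := levD k.+1; have := fib_gap pk pq.
case: (boolP (odd k)) => ok [] h.
- exists (k, level k x' y'); first exact: mem.
  rewrite /= ok; clear - h E1 E2; lia.
- exists (k.+1, level k.+1 x y); first exact: mem.
  rewrite /= ok /=; clear - h E1 E2; lia.
- exists (k, level k x y); first exact: mem.
  rewrite /= (negbTE ok); clear - h E1 E2; lia.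
- exists (k.+1, level k.+1 x' y'); first exact: mem.
  rewrite /= ok /=; clear - h E1 E2; lia.
Qed.

End Grid.

(** * Choice of the digit ranges and count of the lines *)

Section Levels.
Local Open Scope nat_scope.
Variable t : nat.

(* A rounding of [t ^ 2 / (i * (i + 1))] whose sums telescope. *)
Definition exponent (i : nat) : nat := t ^ 2 %/ i - t ^ 2 %/ i.+1.

Fixpoint exponents (j : nat) : seq nat :=
  if j is j'.+1 then exponent j :: exponents j' else [::].

Definition width (j : nat) : nat := \prod_(k <- exponents j) fib k.

Lemma widthS j : width j.+1 = fib (exponent j.+1) * width j.
Proof. by rewrite /width big_cons. Qed.

Lemma div_sq_leS i : t ^ 2 %/ i.+2 <= t ^ 2 %/ i.+1.
Proof. exact: leq_div2l. Qed.

Lemma div_sq_leq j i : j <= i -> t ^ 2 %/ i.+1 <= t ^ 2 %/ j.+1.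
Proof. by move=> ji; apply: leq_div2l. Qed.

Lemma all_exponents j : all (leq^~ (t ^ 2)) (exponents j).
Proof.
elim: j => // j IH; rewrite /= IH andbT.
exact: leq_trans (leq_subr _ _) (leq_div _ _).
Qed.

(** The exponents telescope, and each added factor costs at most 2 by [fib_mul_bounds]. *)
Lemma width_ge j i :
  width j * fib (t ^ 2 %/ j.+1 - t ^ 2 %/ (j + i).+1) <= 2 ^ i * width (j + i).
Proof.
elim: i => [|i IH]; first by rewrite addn0 subnn muln1 mul1n.
rewrite addnS widthS; set k := exponent _.
have -> : t ^ 2 %/ j.+1 - t ^ 2 %/ (j + i).+2 = (t ^ 2 %/ j.+1 - t ^ 2 %/ (j + i).+1) + k.
  have := div_sq_leS (j + i); have := div_sq_leq (leq_addr i j).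
  by rewrite /k /exponent; lia.
have /andP[_ le] := fib_mul_bounds (t ^ 2 %/ j.+1 - t ^ 2 %/ (j + i).+1) k.
apply: leq_trans (leq_mul (leqnn _) le) _.
have := leq_mul (leqnn (2 * fib k)) IH; congr (_ <= _); first by ring.
by rewrite expnS; ring.
Qed.

Lemma width_le j : width j <= fib (t ^ 2 - t ^ 2 %/ j.+1).
Proof.
elim: j => [|j IH]; first by rewrite /width big_nil fib_gt0.
rewrite widthS; set k := exponent _.
have -> : t ^ 2 - t ^ 2 %/ j.+2 = k + (t ^ 2 - t ^ 2 %/ j.+1).
  have := div_sq_leS j; have := leq_div (t ^ 2) j.+1; rewrite /k /exponent.
  by move: (t ^ 2) (_ %/ j.+1) (_ %/ j.+2) => T p q; clear; lia.
have /andP[le _] := fib_mul_bounds k (t ^ 2 - t ^ 2 %/ j.+1).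
by apply: leq_trans le; rewrite leq_mul2l IH orbT.
Qed.

Lemma div_sq_last : t ^ 2 %/ t.+1 <= t.
Proof. by rewrite -ltnS ltn_divLR // -mulnn; lia. Qed.

Lemma mul_exponent_le j : j * exponent j <= t ^ 2 %/ j.+1 + j.
Proof.
case: j => // j; rewrite /exponent.
have h1 := leq_trunc_div (t ^ 2) j.+1; have h2 := divn_eq (t ^ 2) j.+2.
have h3 := ltn_pmod (t ^ 2) (ltn0Sn j.+1); have h4 := div_sq_leS j.
move: (t ^ 2) (_ %/ j.+1) (_ %/ j.+2) (_ %% _) h1 h2 h3 h4 => T p q r h1 h2 h3 _.
clear - h1 h2 h3; nia.
Qed.

Lemma fib3_le k : fib k.+3 <= 8 * fib k.
Proof. by have := fib_leD k 3; rewrite addn3. Qed.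

(** Up to [2 ^ O(t)], [fib (exponent j) ^ j] is at most [fib (t ^ 2 %/ j.+1)], the factor by which
    [width] still grows from [j] to [t]. The base 64 is 8 * 4 * 2, from [fib3_le], the rounding of
    exponents and [width_ge]. *)
Lemma batch_le j : j <= t ->
  \prod_(i <- exponents j) (fib (exponent j).+3 * fib i) <= 64 ^ t * width t.
Proof.
move=> jt; rewrite big_split /= -/(width j).
have -> : \prod_(i <- exponents j) fib (exponent j).+3 = fib (exponent j).+3 ^ j.
  rewrite big_const_seq count_predT iter_muln_1; congr (_ ^ _).
  by elim: (j) => // i IH; rewrite /= IH.
apply: (@leq_trans (8 ^ j * fib (exponent j) ^ j * width j)).
  rewrite leq_mul2r -expnMn; apply/orP; right.
  by case: (j) => // i; rewrite leq_exp2r // fib3_le.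
apply: (@leq_trans (8 ^ t * (4 ^ t * fib (t ^ 2 %/ j.+1 - t ^ 2 %/ t.+1)) * width j)).
  rewrite leq_mul2r; apply/orP; right; apply: leq_mul; first by rewrite leq_exp2l.
  apply: leq_trans (fib_exp_le _ _) _.
  apply: leq_trans (leq_fib (mul_exponent_le _)) _.
  have e : t ^ 2 %/ j.+1 + j =
      (t ^ 2 %/ j.+1 - t ^ 2 %/ t.+1) + (t ^ 2 %/ t.+1 + j).
    by have := div_sq_leq jt; lia.
  rewrite e; apply: leq_trans (fib_leD _ _) _.
  rewrite leq_mul2r; apply/orP; right; rewrite -(expnM 2 2) leq_exp2l //.
  by have := div_sq_last; lia.
have := width_ge j (t - j); rewrite subnKC // => wg.
have := leq_mul (leqnn (8 ^ t * 4 ^ t)) wg.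
have l2 : 2 ^ (t - j) <= 2 ^ t by rewrite leq_exp2l // leq_subr.
move=> h; apply: (@leq_trans (8 ^ t * 4 ^ t * (2 ^ (t - j) * width t))).
  by apply: leq_trans h; apply: eq_leq; ring.
apply: (@leq_trans (8 ^ t * 4 ^ t * (2 ^ t * width t))); first by rewrite !leq_mul.
by rewrite mulnA -!expnMn.
Qed.

Lemma size_grid_exponents B j : size (grid B (exponents j)) = width j.
Proof. by rewrite /grid size_digits; apply: eq_bigr => i _; rewrite mul1n. Qed.

Lemma size_helpers_exponents B j : j <= t ->
  size (helpers B (exponents j)) <= 2 * j * (64 ^ t * width t).
Proof.
elim: j => // j IH jt; rewrite size_helpers -/(exponents j.+1).
have := leq_add (IH (ltnW jt)) (leq_mul (leqnn 2) (batch_le jt)).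
by move/leq_trans; apply; apply: eq_leq; ring.
Qed.

(** Uses [fib (t ^ 2)] in place of [width t]; the two agree up to a factor [4 ^ t]. *)
Definition lines_bound : nat := 2 * 128 ^ t * fib (t ^ 2).

Lemma fib_sq_le_width : fib (t ^ 2) <= 4 ^ t * width t.
Proof.
have := width_ge 0 t; rewrite add0n divn1 /width big_nil mul1n -/(width t).
move=> h; have e : t ^ 2 = (t ^ 2 - t ^ 2 %/ t.+1) + t ^ 2 %/ t.+1.
  by rewrite subnK // leq_div.
rewrite [leqLHS](congr1 fib e); apply: leq_trans (fib_leD _ _) _.
apply: (@leq_trans (2 ^ t * (2 ^ t * width t))).
  by rewrite leq_mul // leq_exp2l // div_sq_last.
by rewrite mulnA -expnMn.
Qed.

Lemma size_lines_le B :
  2 * size (grid B (exponents t)) + size (helpers B (exponents t)) <= lines_bound.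
Proof.
rewrite size_grid_exponents.
apply: leq_trans (leq_add (leqnn _) (size_helpers_exponents B (leqnn t))) _.
have w : width t <= fib (t ^ 2).
  by apply: leq_trans (width_le _) _; apply: leq_fib; exact: leq_subr.
apply: leq_trans (_ : 2 * 128 ^ t * width t <= _); last by rewrite leq_mul2l w orbT.
(* The number of levels and the grid lines are absorbed by one more factor [2 ^ t]. *)
have t2 : t.+1 <= 2 ^ t by exact: ltn_expl.
have p64 : 1 <= 64 ^ t by rewrite expn_gt0.
have -> : 128 ^ t = 2 ^ t * 64 ^ t by rewrite -expnMn.
apply: (@leq_trans (2 * (t.+1 * 64 ^ t) * width t)); last first.
  by rewrite leq_mul2r leq_mul2l leq_mul2r t2 !orbT.
move: (64 ^ t) p64 => p p0; clear -p0; nia.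
Qed.

End Levels.

(** * Perturbation into general position *)

Section Perturbation.
Variable R : realType.
Implicit Types (p q r : plane R) (a b c t : R).

Lemma quadratic_lt0_near0 a b c : a < 0 ->
  \forall t \near (0 : R)^'+, a + b * t + c * t ^+ 2 < 0.
Proof.
move=> a0; apply: (@cvgr_lt _ _ _ _ _ a) => //.
have: {for 0, continuous (fun t : R => a + b * t + c * t ^+ 2)}.
  move=> t; apply: cvgD; [apply: cvgD; [exact: cvg_cst|]|].
    by apply: cvgM; [exact: cvg_cst|exact: cvg_id].
  apply: cvgM; [exact: cvg_cst|exact: exprn_continuous].
rewrite /prop_for /continuous_at expr0n/= !mulr0 !addr0.
exact: cvg_at_right_filter.
Qed.

Lemma quadratic_neq0_near0 a b c : c != 0 ->
  \forall t \near (0 : R)^'+, a + b * t + c * t ^+ 2 != 0.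
Proof.
have neq0 x y z : x != 0 -> \forall t \near (0 : R)^'+, x + y * t + z * t ^+ 2 != 0.
  rewrite neq_lt => /orP[x0|x0].
    near=> t; rewrite lt_eqF //; near: t; exact: quadratic_lt0_near0.
  near=> t; rewrite gt_eqF // -oppr_lt0.
  rewrite (_ : - _ = - x + - y * t + - z * t ^+ 2); last by ring.
  by near: t; apply: quadratic_lt0_near0; rewrite oppr_lt0.
move=> c0; have [->|a0] := eqVneq a 0; last exact: neq0.
have [->|b0] := eqVneq b 0; near=> t.
  have t0 : 0 < t by near: t; exact: nbhs_right_gt.
  by rewrite mul0r !add0r mulf_neq0 // expf_neq0 // gt_eqF.
have t0 : 0 < t by near: t; exact: nbhs_right_gt.
rewrite add0r (_ : _ + _ = t * (b + c * t + 0 * t ^+ 2)); last by ring.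
apply: mulf_neq0; first by rewrite gt_eqF.
by near: t; exact: neq0.
Unshelve. all: by end_near. Qed.

Definition det3 p q r : R :=
  (q.1 - p.1) * (r.2 - p.2) - (r.1 - p.1) * (q.2 - p.2).

Lemma collinear_det3 p q r : collinear p q r -> det3 p q r = 0.
Proof.
move=> [_ [[a [b [c [ab ->]]]]]] /= ep eq er.
have e1 : a * (q.1 - p.1) + b * (q.2 - p.2) = 0 by lra.
have e2 : a * (r.1 - p.1) + b * (r.2 - p.2) = 0 by lra.
have ea : a * det3 p q r = 0.
  transitivity ((a * (q.1 - p.1) + b * (q.2 - p.2)) * (r.2 - p.2)
    - (a * (r.1 - p.1) + b * (r.2 - p.2)) * (q.2 - p.2)); first by rewrite /det3; ring.
  by rewrite e1 e2 !mul0r subrr.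
have eb : b * det3 p q r = 0.
  transitivity ((a * (r.1 - p.1) + b * (r.2 - p.2)) * (q.1 - p.1)
    - (a * (q.1 - p.1) + b * (q.2 - p.2)) * (r.1 - p.1)); first by rewrite /det3; ring.
  by rewrite e1 e2 !mul0r subrr.
apply/eqP; apply: contraPT ab => d0 ab.
move/eqP: ea; rewrite mulf_eq0 (negbTE d0) orbF => /eqP a0.
move/eqP: eb; rewrite mulf_eq0 (negbTE d0) orbF => /eqP b0.
by apply: ab; rewrite a0 b0.
Qed.

(** Displacement in the direction of [(i, i ^ 2)] on a parabola: for distinct indices, the leading
    coefficient of [det3] in [t] is a nonzero Vandermonde determinant, whatever the starting
    points. *)
Definition shift p t (i : nat) : plane R := (p.1 + t * i%:R, p.2 + t * i%:R ^+ 2).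

Lemma shift_neq_near0 p q (i j : nat) : i != j ->
  \forall t \near (0 : R)^'+, shift p t i != shift q t j.
Proof.
move=> ij; have ij0 : (i%:R - j%:R : R) != 0 by rewrite subr_eq0 eqr_nat.
have := @quadratic_neq0_near0 0 (p.1 - q.1) _ ij0.
apply: filter_app; near=> t; apply: contra => /eqP[e _].
rewrite add0r (_ : _ + _ = t * ((p.1 + t * i%:R) - (q.1 + t * j%:R))); last by ring.
by rewrite e subrr mulr0.
Unshelve. all: by end_near. Qed.

Lemma shift_det3_near0 p q r (i j k : nat) : i != j -> i != k -> j != k ->
  \forall t \near (0 : R)^'+, det3 (shift p t i) (shift q t j) (shift r t k) != 0.
Proof.
move=> ij ik jk.
have vdm : ((j%:R - i%:R) * (k%:R - i%:R) * (k%:R - j%:R) : R) != 0.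
  by rewrite !mulf_neq0 // subr_eq0 eqr_nat eq_sym.
have := @quadratic_neq0_near0 (det3 p q r)
  ((q.1 - p.1) * (k%:R ^+ 2 - i%:R ^+ 2) + (j%:R - i%:R) * (r.2 - p.2)
   - ((r.1 - p.1) * (j%:R ^+ 2 - i%:R ^+ 2) + (k%:R - i%:R) * (q.2 - p.2))) _ vdm.
apply: filter_app; near=> t; congr (_ != _); rewrite /det3 /shift /=; ring.
Unshelve. all: by end_near. Qed.

Lemma shift_lt_near0 a c p i : a * p.1 + p.2 < c ->
  \forall t \near (0 : R)^'+, a * (shift p t i).1 + (shift p t i).2 < c.
Proof.
rewrite -subr_lt0 => h.
have := @quadratic_lt0_near0 _ (a * i%:R + i%:R ^+ 2) 0 h.
by apply: filter_app; near=> t; rewrite -[_ < c]subr_lt0; congr (_ < _);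
  rewrite /shift /=; ring.
Unshelve. all: by end_near. Qed.

Lemma shift_gt_near0 a c p i : c < a * p.1 + p.2 ->
  \forall t \near (0 : R)^'+, c < a * (shift p t i).1 + (shift p t i).2.
Proof.
rewrite -subr_lt0 => h.
have := @quadratic_lt0_near0 _ (- (a * i%:R + i%:R ^+ 2)) 0 h.
by apply: filter_app; near=> t; rewrite -[c < _]subr_lt0; congr (_ < _);
  rewrite /shift /=; ring.
Unshelve. all: by end_near. Qed.

(* [v] stands for the half-plane [v.1 * q.1 + q.2 <= v.2]; since the separations
   are strict they survive the perturbation of [ps] into general position. *)
Lemma separated_antichain (n : nat) (ps hs : seq (plane R)) :
  (size ps <= n)%N -> uniq hs ->
  {in hs &, forall v w, v != w -> exists2 p, p \in ps &
    v.1 * p.1 + p.2 < v.2 /\ w.2 < w.1 * p.1 + p.2} ->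
  antichain_size R n (size hs).
Proof.
(* Indices beyond [ps] take the default 0 and become distinct shifts of the origin, padding the set
   to exactly [n] points. *)
move=> psn uhs sep; pose f t i := shift (nth 0 ps i) t i.
have : \forall t \near (0 : R)^'+,
    [/\ forall i j : 'I_n, i != j -> f t i != f t j,
        forall i j k : 'I_n, i != j -> i != k -> j != k ->
          det3 (f t i) (f t j) (f t k) != 0 &
        forall (v w : 'I_(size hs)), v != w ->
          let V := nth 0 hs v in let W := nth 0 hs w in
          exists i : 'I_n, V.1 * (f t i).1 + (f t i).2 <= V.2 /\
                           W.2 < W.1 * (f t i).1 + (f t i).2].
  near=> t; split; near: t.
  - apply: filter_forall => i; apply: filter_forall => j.
    case: (boolP (i == j)) => ij; first exact: nearW.
    have := @shift_neq_near0 (nth 0 ps i) (nth 0 ps j) _ _ ij.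
    by apply: filter_app; near=> t.
  - apply: filter_forall => i; apply: filter_forall => j; apply: filter_forall => k.
    case: (boolP (i == j)) => ij; first exact: nearW.
    case: (boolP (i == k)) => ik; first exact: nearW.
    case: (boolP (j == k)) => jk; first exact: nearW.
    have := @shift_det3_near0 (nth 0 ps i) (nth 0 ps j) (nth 0 ps k) _ _ _ ij ik jk.
    by apply: filter_app; near=> t.
  - apply: filter_forall => v; apply: filter_forall => w.
    case: (boolP (v == w)) => vw; first exact: nearW.
    set V := nth 0 hs v; set W := nth 0 hs w.
    have VW : V != W by rewrite nth_uniq.
    have [p pP [h1 h2]] := sep V W (mem_nth _ (ltn_ord v)) (mem_nth _ (ltn_ord w)) VW.
    have ip : (index p ps < n)%N by apply: leq_trans psn; rewrite index_mem.
    have := @shift_lt_near0 _ _ _ (index p ps) h1.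
    have := @shift_gt_near0 _ _ _ (index p ps) h2.
    apply: filter_app2; near=> t => g2 g1 _.
    by exists (Ordinal ip); rewrite /f /= nth_index // ltW.
move=> H.
case: (@filter_ex R _ (at_right_proper_filter (0 : R)) _ H) => t [finj fdet fsep].
pose P := f t @` `I_n.
pose A (v : nat) := P `&`
  [set q | (nth 0 hs v).1 * q.1 + 1 * q.2 <= (nth 0 hs v).2].
(* Yields both the antichain property and the injectivity of [A]. *)
have Asub v w : (v < size hs)%N -> (w < size hs)%N -> A v `<=` A w -> v = w.
  move=> vs ws sub; apply/eqP; apply: contraPT sub => vw sub.
  have [i [h1 h2]] := fsep (Ordinal vs) (Ordinal ws) vw.
  have [|_] := sub (f t i).
    by split; [exists i => //=; exact: ltn_ord|rewrite /= mul1r].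
  by rewrite /= mul1r leNgt h2.
exists P, (A @` `I_(size hs)); split.
- apply: inj_card_eq => i j /set_mem/= iN /set_mem/= jN /eqP; apply: contraTeq => ij.
  exact: (finj (Ordinal iN) (Ordinal jN)).
- move=> _ _ _ [i /= iN <-] [j /= jN <-] [k /= kN <-] ij jk ik /collinear_det3/eqP.
  apply/negP; apply: (fdet (Ordinal iN) (Ordinal jN) (Ordinal kN)); apply/eqP.
  + by move=> [e]; apply: ij; rewrite e.
  + by move=> [e]; apply: ik; rewrite e.
  + by move=> [e]; apply: jk; rewrite e.
- move=> _ [v /= _ <-]; exists [set q | (nth 0 hs v).1 * q.1 + 1 * q.2 <= (nth 0 hs v).2].
  split=> //; exists (nth 0 hs v).1, 1, (nth 0 hs v).2; split=> //.
  by move=> [_ /eqP]; rewrite oner_eq0.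
- by move=> _ _ [v /= vs <-] [w /= ws <-] /(Asub _ _ vs ws) ->.
- apply: inj_card_eq => v w /set_mem/= vs /set_mem/= ws e.
  by apply: (Asub _ _ vs ws); rewrite e.
Unshelve. all: by end_near. Qed.

End Perturbation.

(** * Duality between lines and points, directed by the golden ratio *)

Section Duality.
Variable R : realType.

Definition golden : R := (1 + Num.sqrt 5) / 2.

Lemma golden_sqr : golden ^+ 2 = golden + 1.
Proof.
have s5 : Num.sqrt 5 ^+ 2 = 5 :> R by rewrite sqr_sqrtr.
by rewrite /golden; move: s5; set s := Num.sqrt _ => s5; field: s5.
Qed.

Lemma golden_gt1 : 1 < golden.
Proof.
have : (1 : R) < Num.sqrt 5 by rewrite -[ltLHS]sqrtr1 ltr_sqrt ?ltr1n.
by rewrite /golden; lra.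
Qed.

(** [1 - golden] is the conjugate root of [x ^ 2 = x + 1], so each step multiplies the error by
    it. *)
Lemma golden_fib k :
  golden * (fib k)%:R - (fib k.+1)%:R = - (1 - golden) ^+ k.+1.
Proof.
elim: k => [|k IH]; first by rewrite expr1 /=; ring.
rewrite exprS -mulrN -IH fibSS natrD.
have -> : (1 - golden) * (golden * (fib k)%:R - (fib k.+1)%:R) =
  (golden - golden ^+ 2) * (fib k)%:R - (1 - golden) * (fib k.+1)%:R by ring.
by rewrite golden_sqr; ring.
Qed.

Lemma golden_fib_sign k : let l := golden * (fib k)%:R - (fib k.+1)%:R in
  if odd k then l < 0 else 0 < l.
Proof.
rewrite /= golden_fib oppr_lt0 oppr_gt0 -[1 - golden]opprB.
have g0 : 0 < golden - 1 by rewrite subr_gt0 golden_gt1.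
rewrite exprNn -signr_odd /=; case: (odd k) => /=.
  by rewrite expr0 mul1r exprn_gt0.
by rewrite expr1 mulN1r oppr_lt0 exprn_gt0.
Qed.

(* Dual of the line [a x + b y = c], oriented towards [a x + b y > c]; the
   orientation puts the point at infinity of direction [(-1, golden)], which
   the duality sends to the vertical direction, on the positive side when
   [golden * b - a > 0]. *)
Definition dual_line (a b c : R) : plane R :=
  (b / (golden * b - a), c / (golden * b - a)).

Definition dual_point (x y : R) : plane R := (- (golden * x + y), - x).

(** With a positive denominator, the dual point lies strictly inside the half-plane of [(x, y)]
    exactly when [(x, y)] is on the positive side of the line. *)
Lemma dualE a b c x y : golden * b - a != 0 ->
  let v := dual_point x y in let p := dual_line a b c in
  v.1 * p.1 + p.2 - v.2 = (c - (a * x + b * y)) / (golden * b - a).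
Proof. by move=> l0; rewrite /=; field. Qed.

Lemma dual_separates a b c x y x' y' : 0 < golden * b - a ->
  c < a * x + b * y -> a * x' + b * y' < c ->
  let v := dual_point x y in let w := dual_point x' y' in
  let p := dual_line a b c in
  v.1 * p.1 + p.2 < v.2 /\ w.2 < w.1 * p.1 + p.2.
Proof.
move=> l0 h1 h2 /=; have l1 := lt0r_neq0 l0.
split; rewrite -subr_lt0.
  by rewrite dualE // pmulr_llt0 ?invr_gt0 // subr_lt0.
by rewrite -oppr_gt0 opprB dualE // pmulr_lgt0 ?invr_gt0 // subr_gt0.
Qed.

Lemma dual_lineN a b c : dual_line (- a) (- b) (- c) = dual_line a b c.
Proof.
rewrite /dual_line (_ : _ * - b - - a = - (golden * b - a)); last by ring.
by rewrite invrN !mulrNN.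
Qed.

Lemma grid_antichain (K B n : nat) (ks : seq nat) :
  all (leq^~ K) ks -> (fib K.+3 * fib K <= B)%N ->
  (2 * size (grid B ks) + size (helpers B ks) <= n)%N ->
  antichain_size R n (size (grid B ks) ^ 2).
Proof.
move=> ksK KB; set X := grid B ks => sn.
have uX : uniq X.
  apply: uniq_grid; apply: sub_all ksK => k kK; apply: leq_trans KB.
  by apply: leq_trans (leq_fib kK) _; rewrite leq_pmull ?fib_gt0.
(* The offset puts each line strictly between consecutive integer levels. *)
pose half (c : nat) : R := c%:R - 2^-1.
pose hs := [seq dual_point x%:R y%:R | x <- X, y <- X].
pose ps := [seq dual_line 0 1 (half c) | c <- X] ++
  (* Vertical lines point leftwards, so that these and the horizontal ones leave only pairs with
     [x' <= x] and [y <= y']. *)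
  [seq dual_line (-1) 0 (- half c) | c <- X] ++
  [seq dual_line (fib h.1.+1)%:R (fib h.1)%:R (half h.2) | h <- helpers B ks].
have -> : (size X ^ 2)%N = size hs by rewrite size_allpairs.
have halfP (c m m' : nat) : (m < c <= m')%N -> m%:R < half c /\ half c < m'%:R.
  by move=> /andP[]; rewrite -(ler_nat R) -(ler_nat R c) -natr1 /half; split; lra.
apply: (@separated_antichain _ _ ps).
- by rewrite !size_cat !size_map addnA addnn -mul2n.
- apply: allpairs_uniq => // -[x y] [x' y'] _ _ /= [] e /oppr_inj/eqP.
  rewrite eqr_nat => /eqP ex; move: e; rewrite ex => /oppr_inj/addrI/eqP.
  by rewrite eqr_nat => /eqP ->.
move=> _ _ /allpairsP[[x y] [/= xX yX ->]] /allpairsP[[x' y'] [/= x'X y'X ->]] ne.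
have g1 := golden_gt1.
have [yy|yy] := ltnP y' y.
  exists (dual_line 0 1 (half y)).
    by rewrite mem_cat; apply/orP; left; apply/mapP; exists y.
  have [|h1 h2] := halfP y y' y; first by rewrite yy leqnn.
  by apply: dual_separates; lra.
have [xx|xx] := ltnP x x'.
  exists (dual_line (-1) 0 (- half x')).
    by rewrite !mem_cat; apply/orP; right; apply/orP; left; apply/mapP; exists x'.
  have [|h1 h2] := halfP x' x x'; first by rewrite xx leqnn.
  by apply: dual_separates; lra.
have ne' : (x, y) != (x', y') by apply: contra ne => /eqP[-> ->].
have [[k c] /andP[hP _] /=] := helper_separates ksK KB xX yX x'X y'X xx yy ne'.
move=> sep; exists (dual_line (fib k.+1)%:R (fib k)%:R (half c)).
  by rewrite !mem_cat; apply/orP; right; apply/orP; right; apply/mapP; exists (k, c).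
have := golden_fib_sign k; move: sep.
case: (odd k) => /halfP; rewrite /level !natrD !natrM => -[h1 h2] l0.
  (* For odd [k] the denominator is negative; reversing the line keeps its dual and makes it
     positive. *)
  by rewrite -dual_lineN; apply: dual_separates; lra.
by apply: dual_separates; lra.
Qed.

End Duality.

(** * Growth of the bounds and interpolation in [n] *)

Section Bounds.
Local Open Scope nat_scope.

Lemma fib_sqr_ge k : 2 ^ k <= 2 * fib k ^ 2.
Proof.
suff [] : 2 ^ k <= 2 * fib k ^ 2 /\ 2 ^ k.+1 <= 2 * fib k.+1 ^ 2 by [].
elim: k => // k [IH1 IH2]; split=> //.
have h : 2 * fib k <= fib k.+2 by rewrite fibSS mul2n -addnn leq_add2r fib_leS.
apply: leq_trans (_ : 2 * (2 * fib k) ^ 2 <= _); last by rewrite leq_mul2l leq_exp2r.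
by rewrite !expnS expnMn; lia.
Qed.

(** Forces [t = O(sqrt (log n))] once [lines_bound t <= n]. *)
Lemma lines_bound_sqr_ge t : 2 ^ (t ^ 2) <= lines_bound t ^ 2.
Proof.
apply: leq_trans (fib_sqr_ge _) _; rewrite /lines_bound !expnMn leq_mul2r.
apply/orP; right; apply: (@leq_trans (2 ^ 2 * 1)) => //.
by rewrite leq_mul // !expn_gt0.
Qed.

Lemma leq_lines_bound t : t <= lines_bound t.
Proof.
apply: leq_trans (ltnW (@ltn_expl 128 t isT)) _.
by rewrite /lines_bound mulnAC leq_pmull // muln_gt0 fib_gt0.
Qed.

(** As [(t + 1) ^ 2 = t ^ 2 + 2 * t + 1], passing to [t.+1] costs only [2 ^ O(t)], which handles
    every [n] between two bounds. *)
Lemma lines_boundS_le t : lines_bound t.+1 <= 512 * 2048 ^ t * width t t.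
Proof.
rewrite /lines_bound (_ : t.+1 ^ 2 = t ^ 2 + t.*2.+1); last by rewrite -!mulnn; lia.
have h := leq_trans (fib_leD (t ^ 2) t.*2.+1) (leq_mul (leqnn _) (fib_sq_le_width t)).
apply: leq_trans (leq_mul (leqnn _) h) _; apply: eq_leq.
rewrite (_ : 2048 = 128 * 4 * 4) // !expnMn !expnS -mul2n expnM.
by move: (128 ^ t) (4 ^ t) (width t t) => a b w; ring.
Qed.

Lemma lines_bound_sandwich n : 2 <= n ->
  exists t, lines_bound t <= n < lines_bound t.+1.
Proof.
(* [lines_bound 0] equals 2. *)
move=> n2; have ex : exists t, lines_bound t <= n by exists 0.
have ub t : lines_bound t <= n -> t <= n by apply: leq_trans (leq_lines_bound t).
case: (ex_maxnP ex ub) => t tn tmax; exists t; rewrite tn /= ltnNge.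
by apply/negP => /tmax; rewrite ltnn.
Qed.

Lemma g_ge (R : realType) n t : lines_bound t <= n -> width t t ^ 2 <= g R n.
Proof.
move=> tn; set B := fib (t ^ 2).+3 * fib (t ^ 2).
rewrite -(size_grid_exponents t B t); apply: g_max.
apply: (@grid_antichain _ (t ^ 2)) => //; first exact: all_exponents.
exact: leq_trans (size_lines_le _ _) tn.
Qed.

End Bounds.

Theorem theorem1 (R : realType) :
  exists d c : R, [/\ 0 < d, 0 < c &
    \forall n \near \oo,
      c * n%:R `^ (2 - d / Num.sqrt (ln n%:R)) <= (g R n)%:R].
Proof.
have ln2 : 0 < ln 2 :> R by rewrite ln_gt0 // ltr1n.
pose s : R := Num.sqrt (2 / ln 2).
have s0 : 0 < s by rewrite sqrtr_gt0 divr_gt0.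
have c0 : 0 < 512 :> R by rewrite ltr0n.
(* Squaring [width] doubles the 11 of [2048 = 2 ^ 11] and squares the 512 of [lines_boundS_le]; [s]
   comes from [t ^ 2 * ln 2 <= 2 * ln n]. *)
exists (22 * ln 2 * s), (512 ^+ 2)^-1; split.
- by rewrite !mulr_gt0.
- by rewrite invr_gt0; exact: exprn_gt0 c0.
exists 2%N => // n /= n2.
have [t /andP[tn nt]] := lines_bound_sandwich n2.
apply: (@le_trans _ _ ((width t t)%:R ^+ 2)); last first.
  by rewrite -natrX ler_nat g_ge.
have n0 : 0 < n%:R :> R by rewrite ltr0n (leq_trans _ n2).
set L : R := ln n%:R.
have L0 : 0 < L by rewrite ln_gt0 // ltr1n.
have nL : n%:R = expR L :> R by rewrite lnK // posrE.
have pow2 (k : nat) : (2 ^ k)%:R = expR (k%:R * ln 2) :> R.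
  by rewrite natrX -[in LHS](@lnK _ 2) ?posrE // expRM_natl.
have tL : t%:R <= s * Num.sqrt L.
  have : (2 ^ (t ^ 2))%:R <= (n ^ 2)%:R :> R.
    by rewrite ler_nat (leq_trans (lines_bound_sqr_ge t)) // leq_exp2r.
  rewrite pow2 (natrX _ n) nL -expRM_natl ler_expR natrX => h.
  rewrite /s -sqrtrM; last by rewrite divr_ge0 // ltW.
  rewrite -[leLHS]ger0_norm // -sqrtr_sqr ler_sqrt; last first.
    by rewrite mulr_ge0 ?divr_ge0 // ltW.
  by rewrite mulrAC ler_pdivlMr.
have n_le : expR L <= 512 * expR (11 * t%:R * ln 2) * (width t t)%:R.
  rewrite -nL -natrM -pow2 expnM -!natrM ler_nat ltnW //.
  exact: leq_trans nt (lines_boundS_le t).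
rewrite (ler_pdivrMl _ _ (exprn_gt0 2 c0)) /powR (gt_eqF n0) -/L.
have -> : (2 - 22 * ln 2 * s / Num.sqrt L) * L =
    2%:R * L - 22 * ln 2 * s * Num.sqrt L.
  have : 0 < Num.sqrt L by rewrite sqrtr_gt0.
  have := sqr_sqrtr (ltW L0); set q := Num.sqrt L => <- q0.
  by field; exact: lt0r_neq0.
(* Once [tL] has brought back [t], what remains is the square of [n_le]. *)
apply: (@le_trans _ _ (expR (2%:R * L - 2%:R * (11 * t%:R * ln 2)))).
  rewrite ler_expR lerB //; have := ler_wpM2l (ltW ln2) tL; lra.
rewrite expRD expRN ler_pdivrMr ?expR_gt0 // !expRM_natl -!exprMn.
apply: lerXn2r; [exact: expR_ge0| |by rewrite mulrAC].
exact: mulr_ge0 (mulr_ge0 (ltW c0) (ler0n _ _)) (expR_ge0 _).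
Qed.
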